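(* For all integers $n,m \geq 5$, $\gamma_p(KN_{n,m}) = nm$; that is, the only perfect dominating set of the knights graph $KN_{n,m}$ is its whole vertex set.
   Context: For a graph $G=(V,E)$, a set $S\subseteq V$ is a perfect dominating set if every vertex $v\in V\setminus S$ is adjacent to exactly one vertex of $S$. The perfect domination number $\gamma_p(G)$ is the minimum cardinality of a perfect dominating set of $G$. The knights graph $KN_{n,m}$ has vertex set $\{(i,j): 1\le i\le n,\ 1\le j\le m\}$ (squares of a chessboard with $n$ columns and $m$ rows, $(i,j)$ being column $i$, row $j$), and $(a,b)$ is adjacent to $(c,d)$ iff $\{|a-c|,|b-d|\}=\{1,2\}$ (a knight's move). *)

(* Defs.v *)
From mathcomp Require Import all_boot all_order all_algebra.
Set Implicit Arguments.
Unset Strict Implicit.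
Unset Printing Implicit Defensive.

(* A graph on a finite vertex type T is given by its adjacency relation. *)
Section PerfectDomination.

Variables (T : finType) (adj : rel T).

Definition perfect_dominating (S : {set T}) : bool :=
  [forall v, (v \notin S) ==> (#|[set u in S | adj v u]| == 1)].

Lemma perfect_dominating_setT : perfect_dominating [set: T].
Proof. by apply/forallP => v; rewrite in_setT. Qed.

(* The seed [set: T] of the minimization is always admissible, by
   perfect_dominating_setT, so this is a genuine minimum. *)
Definition perfect_domination_number : nat :=
  #|[arg min_(S < [set: T] | perfect_dominating S) #|S| ]|.

Lemma perfect_domination_number_attained :
  exists2 S, perfect_dominating S & #|S| = perfect_domination_number.
Proof.
rewrite /perfect_domination_number.
by case: arg_minnP => [|S pS _]; [exact: perfect_dominating_setT | exists S].
Qed.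

Lemma perfect_domination_number_le S :
  perfect_dominating S -> perfect_domination_number <= #|S|.
Proof.
rewrite /perfect_domination_number.
by case: arg_minnP => [|S' _]; [exact: perfect_dominating_setT | apply].
Qed.

End PerfectDomination.

(* Squares are numbered from 0: the pair (i, j) is the square in column i + 1
   and row j + 1, which leaves coordinate differences unchanged. *)
Definition knight_adj (n m : nat) : rel ('I_n * 'I_m) :=
  fun p q =>
    let dx := `|(p.1 : nat) - (q.1 : nat)|%N in
    let dy := `|(p.2 : nat) - (q.2 : nat)|%N in
    ((dx == 1) && (dy == 2)) || ((dx == 2) && (dy == 1)).

Lemma knight_adj_sym n m : symmetric (@knight_adj n m).
Proof.
by move=> p q; rewrite /knight_adj (distnC p.1) (distnC p.2).
Qed.

Lemma knight_adj_irrefl n m : irreflexive (@knight_adj n m).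
Proof. by move=> p; rewrite /knight_adj !distnn. Qed.

(* Main.v *)
Require Import Defs.
From mathcomp Require Import all_boot.
From mathcomp Require Import ssrint zify.
Set Implicit Arguments.
Unset Strict Implicit.
Unset Printing Implicit Defensive.

(** Let S be perfect dominating.  A square with two neighbours in S lies in S, so
    the 5 x 2 block in a corner spreads first along a strip of five columns, and
    then, from the first two columns, over the whole board.  That the block lies
    in S is decided near the corner: on the window of the squares with both
    coordinates less than 7, knowing that an outer square of the window has at
    most one neighbour in S unless it is itself in S, and that an inner one has
    exactly one, already forces the block.  Only nine windows occur, and each is
    settled by an exhaustive search with unit propagation. *)

Definition square := (nat * nat)%type.

(** * Constraint search on partial assignments and its soundness *)

Section PropagationSearch.

(* The constraint (v, c, N) says that v lies in the set or has at most one
   element of N in the set, and at least one if c holds. *)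
Definition constraint := (square * bool * seq square)%type.

Definition satisfies (P : pred square) (k : constraint) : bool :=
  let: (v, c, N) := k in P v || (count P N <= 1) && (c ==> has P N).

(** Indexed by column, then row. Missing entries default to [None], so [[::]] is the assignment that
    knows nothing. *)
Definition assignment := seq (seq (option bool)).

Definition value (A : assignment) (p : square) : option bool :=
  nth None (nth [::] A p.1) p.2.

Definition assign (A : assignment) (p : square) (b : bool) : assignment :=
  set_nth [::] A p.1 (set_nth None (nth [::] A p.1) p.2 (Some b)).

Definition known_in A p := if value A p is Some true then true else false.
Definition known_out A p := if value A p is Some false then true else false.
Definition unknown A p := if value A p is None then true else false.

Definition violated (A : assignment) (k : constraint) : bool :=
  let: (v, c, N) := k in
  if known_out A v then (1 < count (known_in A) N) || c && all (known_out A) N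
  else false.

Definition forced (A : assignment) (k : constraint) : option square :=
  let: (v, c, N) := k in
  match value A v with
  | Some true => None
  | None =>
      if (1 < count (known_in A) N) || c && all (known_out A) N then Some v
      else None
  | Some false =>
      let free := [seq u <- N | unknown A u] in
      (* A neighbour known in forces every free one out; otherwise, under [c], a single free one is
         forced in. *)
      if has (known_in A) N || c && (size free <= 1) then ohead free else None
  end.

Variables (ks : seq constraint) (order goal : seq square).

(* The choice of the square to branch on is irrelevant to soundness; branching
   on a forced square performs unit propagation, as one branch dies at once. *)
Definition branching_square (A : assignment) : option square :=
  ohead (pmap (forced A) ks ++ [seq u <- order | unknown A u]).

(** Conditionals replace boolean connectives, whose arguments [vm_compute] would all evaluate. Each
    branching fixes an unknown square, so fuel above the number of squares suffices. *)
Fixpoint search (fuel : nat) (A : assignment) : bool :=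
  if all (known_in A) goal then true else
  if has (violated A) ks then true else
  if fuel is fuel'.+1 then
    if branching_square A is Some p then
      if search fuel' (assign A p true) then search fuel' (assign A p false)
      else false
    else false
  else false.

Definition agrees (P : pred square) (A : assignment) : Prop :=
  forall p b, value A p = Some b -> P p = b.

Lemma value_assign A p b q :
  value (assign A p b) q = if q == p then Some b else value A q.
Proof.
case: p q => [x y] [x' y']; rewrite /value /assign /= nth_set_nth /= xpair_eqE.
by case: eqP => [->|_] //=; rewrite nth_set_nth /=.
Qed.

Lemma agrees_assign P A p : agrees P A -> agrees P (assign A p (P p)).
Proof.
move=> PA q b; rewrite value_assign.
by case: eqP => [-> [] | _ /PA].
Qed.

Lemma agrees_known_in P A p : agrees P A -> known_in A p -> P p.
Proof. by rewrite /known_in; case E: value => [[]|] // /(_ _ _ E) ->. Qed.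

Lemma agrees_known_out P A p : agrees P A -> known_out A p -> ~~ P p.
Proof. by rewrite /known_out; case E: value => [[]|] // /(_ _ _ E) ->. Qed.

Lemma agrees_violated P A k : agrees P A -> violated A k -> ~~ satisfies P k.
Proof.
case: k => [[v c] N] PA /=.
case: ifP => // /(agrees_known_out PA) /negbTE -> /= /orP[lt1|/andP[-> out]].
  rewrite negb_and -ltnNge (leq_trans lt1) //.
  by apply: sub_count => u; apply: agrees_known_in.
rewrite negb_and /= -all_predC (sub_all _ out) ?orbT // => u.
exact: agrees_known_out.
Qed.

(** Follow the branch that [P] itself selects: it never meets a violated constraint, so it can only
    succeed by reaching the goal. *)
Lemma search_sound P fuel A :
  all (satisfies P) ks -> agrees P A -> search fuel A -> all P goal.
Proof.
move=> Pks; elim: fuel A => [|fuel IH] A PA /=;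
  case: ifP => [inA _|_]; try exact: sub_all (fun p => agrees_known_in PA) _ inA.
- case: hasP => // -[k /(allP Pks) Pk /(agrees_violated PA)]; by rewrite Pk.
- case: hasP => [[k /(allP Pks) Pk /(agrees_violated PA)]|_]; first by rewrite Pk.
case: branching_square => // p; case: ifP => // st sf.
by apply: (IH (assign A p (P p))); [exact: agrees_assign | case: (P p)].
Qed.

End PropagationSearch.

(** * Corner windows and their exhaustive search *)

Definition knight_move (p q : square) : bool :=
  let dx := `|p.1 - q.1|%N in
  let dy := `|p.2 - q.2|%N in
  ((dx == 1) && (dy == 2)) || ((dx == 2) && (dy == 1)).

Definition rectangle (w h : nat) : seq square :=
  [seq (x, y) | x <- iota 0 w, y <- iota 0 h].

Lemma mem_rectangle w h p : (p \in rectangle w h) = (p.1 < w) && (p.2 < h).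
Proof.
apply/allpairsP/andP => [[[x y] /= [+ + ->]]|[px py]].
  by rewrite !mem_iota.
by exists p; rewrite !mem_iota px py; case: p {px py}.
Qed.

Lemma uniq_rectangle w h : uniq (rectangle w h).
Proof. by rewrite allpairs_uniq ?iota_uniq // => -[? ?] [? ?]. Qed.

(* A w x h corner window; cw and ch bound the coordinates of the squares whose
   neighbours all lie in the window. *)
Definition window_constraints (w cw h ch : nat) : seq constraint :=
  [seq (p, (p.1 < cw) && (p.2 < ch), [seq q <- rectangle w h | knight_move p q])
  | p <- rectangle w h].

(* The three squares tried first were found by experiment to keep the search
   tree small. *)
Definition window_search (w cw h ch : nat) : bool :=
  search (window_constraints w cw h ch)
         ([:: (1, 2); (3, 3); (3, 2)] ++ rectangle w h) (rectangle 5 2) 50 [::].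

Lemma window_search_sound P w cw h ch :
  all (satisfies P) (window_constraints w cw h ch) -> window_search w cw h ch ->
  forall x y, x < 5 -> y < 2 -> P (x, y).
Proof.
rewrite /window_search => Pks found x y x5 y2.
have init : agrees P [::] by move=> p b; rewrite /value !nth_nil.
by apply: (allP (search_sound Pks init found)); rewrite mem_rectangle x5.
Qed.

(** A side of 5 or 6 fits whole, so all its coordinates are inner; a longer one is cut at 7, where
    coordinates below 5 keep their full reach of 2. *)
Definition window_sizes : seq (nat * nat) := [:: (5, 5); (6, 6); (7, 5)].

Lemma window_search_succeeds :
  all (fun w => all (fun h => window_search w.1 w.2 h.1 h.2) window_sizes)
      window_sizes.
Proof. by vm_compute. Qed.

(** * From the corner to the whole board *)

Section PerfectDominatingKnights.

Variables (n m : nat) (S : {set 'I_n * 'I_m}).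
Hypothesis domS : perfect_dominating (@knight_adj n m) S.

Definition coord (v : 'I_n * 'I_m) : square := (v.1 : nat, v.2 : nat).

Lemma coord_inj : injective coord.
Proof. by move=> [x y] [x' y'] [/val_inj -> /val_inj ->]. Qed.

Definition occupied (p : square) : bool := p \in map coord (enum S).

Lemma occupied_coord v : occupied (coord v) = (v \in S).
Proof. by rewrite /occupied (mem_map coord_inj) mem_enum. Qed.

Lemma coordP p : p.1 < n -> p.2 < m -> exists v, coord v = p.
Proof. by case: p => x y ltx lty; exists (Ordinal ltx, Ordinal lty). Qed.

Lemma card_neighbours v : v \notin S -> #|[set u in S | knight_adj v u]| = 1.
Proof. by move=> vS; apply/eqP; move/forallP/(_ v)/implyP: domS; apply. Qed.

Lemma occupied_neighbours_le1 v (N : seq square) :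
  v \notin S -> uniq N -> all (knight_move (coord v)) N -> count occupied N <= 1.
Proof.
move=> vS uN /allP adjN; rewrite -(card_neighbours vS) cardE -(size_map coord).
rewrite -size_filter uniq_leq_size ?filter_uniq // => p.
rewrite mem_filter => /andP[/mapP[u uS ->] /adjN vu].
by rewrite (mem_map coord_inj) mem_enum inE -(mem_enum S) uS.
Qed.

Lemma occupied_two_neighbours p q r :
  p.1 < n -> p.2 < m -> occupied q -> occupied r -> q != r ->
  knight_move p q -> knight_move p r -> occupied p.
Proof.
move=> /coordP pP /pP[v <-] Pq Pr qr vq vr; rewrite occupied_coord.
apply: contraT => vS; have := @occupied_neighbours_le1 v [:: q; r] vS.
by rewrite /= Pq Pr vq vr inE qr => /(_ isT isT).
Qed.

(** The upper bound survives truncating the neighbourhood; the last two hypotheses keep the unique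
    neighbour in [S] of an inner square inside the window. *)
Lemma window_constraints_satisfied w cw h ch :
  w <= n -> h <= m ->
  (forall x y : nat, x < cw -> `|x - y|%N <= 2 -> y < n -> y < w) ->
  (forall x y : nat, x < ch -> `|x - y|%N <= 2 -> y < m -> y < h) ->
  all (satisfies occupied) (window_constraints w cw h ch).
Proof.
move=> wn hm inw inh; apply/allP => _ /mapP[p + ->]; rewrite mem_rectangle.
case/andP=> pw ph; have [v vp] := coordP (leq_trans pw wn) (leq_trans ph hm).
rewrite /= -{1}vp occupied_coord -implyNb; apply/implyP => vS; apply/andP; split.
  apply: (occupied_neighbours_le1 vS); first by rewrite filter_uniq ?uniq_rectangle.
  by rewrite vp filter_all.
apply/implyP=> /andP[pcw pch].
have /eqP/cards1P[u Eu] := card_neighbours vS.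
have /setIdP[uS vu] : u \in [set u in S | knight_adj v u] by rewrite Eu set11.
apply/hasP; exists (coord u); last by rewrite occupied_coord.
have {}vu : knight_move p (coord u) by rewrite -vp.
rewrite mem_filter vu mem_rectangle (inw _ _ pcw) ?(inh _ _ pch) ?ltn_ord //;
  by move: vu; rewrite /knight_move /coord /=; lia.
Qed.

Lemma window_size_exists k :
  5 <= k -> exists2 w, w \in window_sizes &
    w.1 <= k /\ forall x y : nat, x < w.2 -> `|x - y|%N <= 2 -> y < k -> y < w.1.
Proof.
move=> k5; have [k7|k7] := leqP 7 k; first by exists (7, 5) => //=; split; lia.
have [->|->] : k = 5 \/ k = 6 by lia.
  by exists (5, 5) => //=; split; lia.
by exists (6, 6) => //=; split; lia.
Qed.

Hypotheses (n5 : 5 <= n) (m5 : 5 <= m).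

Lemma occupied_corner x y : x < 5 -> y < 2 -> occupied (x, y).
Proof.
move=> x5 y2.
have [w wP [wn inw]] := window_size_exists n5.
have [h hP [hm inh]] := window_size_exists m5.
have Pks := window_constraints_satisfied wn hm inw inh.
have /allP/(_ w wP)/allP/(_ h hP) found := window_search_succeeds.
exact: window_search_sound Pks found _ _ x5 y2.
Qed.

Lemma occupied_strip x y : x < 5 -> y < m -> occupied (x, y).
Proof.
elim/ltn_ind: y x => y IH x x5 ym.
have [y2|y2] := ltnP y 2; first exact: occupied_corner.
(* Columns at distance 1 and 2 from [x], reflected at the left edge to stay in the strip; paired
   with rows [y - 2] and [y - 1], they give two neighbours already known occupied. *)
pose x1 := if x == 0 then 1 else x.-1.
pose x2 := if x < 2 then x + 2 else x - 2.
have x1P : x1 < 5 /\ `|x - x1|%N = 1 by rewrite /x1; case: eqP; lia.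
have x2P : x2 < 5 /\ `|x - x2|%N = 2 by rewrite /x2; case: (ltnP x 2); lia.
clearbody x1 x2.
apply: (@occupied_two_neighbours _ (x1, y - 2) (x2, y - 1)) => /=.
- by lia.
- by [].
- by apply: IH; lia.
- by apply: IH; lia.
- by rewrite xpair_eqE; lia.
- by rewrite /knight_move /=; lia.
- by rewrite /knight_move /=; lia.
Qed.

Lemma occupied_everywhere x y : x < n -> y < m -> occupied (x, y).
Proof.
elim/ltn_ind: x y => x IH y xn ym.
(* The strip supplies the first two columns; the same step then runs with the axes exchanged. *)
have [x2|x2] := ltnP x 2; first by apply: occupied_strip; lia.
pose y1 := if y == 0 then 1 else y.-1.
pose y2 := if y < 2 then y + 2 else y - 2.
have y1P : y1 < m /\ `|y - y1|%N = 1 by rewrite /y1; case: eqP; lia.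
have y2P : y2 < m /\ `|y - y2|%N = 2 by rewrite /y2; case: (ltnP y 2); lia.
clearbody y1 y2.
apply: (@occupied_two_neighbours _ (x - 2, y1) (x - 1, y2)) => /=.
- by lia.
- by [].
- by apply: IH; lia.
- by apply: IH; lia.
- by rewrite xpair_eqE; lia.
- by rewrite /knight_move /=; lia.
- by rewrite /knight_move /=; lia.
Qed.

Lemma perfect_dominating_knights_full : S = [set: 'I_n * 'I_m].
Proof.
apply/setP => v; rewrite in_setT -occupied_coord.
exact: occupied_everywhere.
Qed.

End PerfectDominatingKnights.

Theorem theorem2p1 (n m : nat) (hn : 5 <= n) (hm : 5 <= m) :
  perfect_domination_number (@knight_adj n m) = n * m /\
  (forall S : {set 'I_n * 'I_m},
     perfect_dominating (@knight_adj n m) S <-> S = [set: 'I_n * 'I_m]).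
Proof.
have full S := @perfect_dominating_knights_full n m S.
split=> [|S]; last first.
  by split=> [domS|->]; [exact: full | exact: perfect_dominating_setT].
have [S domS <-] := perfect_domination_number_attained (@knight_adj n m).
by rewrite (full S domS hn hm) cardsT card_prod !card_ord.
Qed.
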